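(* Let $\sigma\ge2$ and let $(v_\circ,\mathcal V,\mathcal E)$ be a rooted connected Toom graph with $\sigma$ charges that is not the trivial Toom graph; let $N:=|V|-1$ and $M:=|\mathcal E|$. Then there exist a unique bijection $\eta:V\to\{0,\dots,N\}$ and incomplete Toom graphs $(\mathcal V'(e),\mathcal E'(e))_{0\le e\le M}$ such that, writing $(\mathcal V(e),\mathcal E(e))$ for the typed directed graph obtained from $(\mathcal V'(e),\mathcal E'(e))$ by relabelling each vertex $u$ as $\eta^{-1}(u)$: (i) $\eta(v_\circ)=0$; (ii) $(\mathcal V'(0),\mathcal E'(0))$ is the trivial incomplete Toom graph and $(\mathcal V(M),\mathcal E(M))=(\mathcal V,\mathcal E)$; (iii) for every $0<e\le M$, $(\mathcal V'(e),\mathcal E'(e))$ is an extension of $(\mathcal V'(e-1),\mathcal E'(e-1))$ at its most urgent loose end.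
   Context: A typed directed graph with vertex set $V$, vertex types $A$, edge types $B$ is a pair $(\mathcal V,\mathcal E)$, $\mathcal V\subset V\times A$, $\mathcal E\subset V\times V\times B$ (an element $(v,w,b)$ is a directed edge from $v$ to $w$ of type $b$), with every vertex having at least one type; $V_a$, $\vec E_b$, $\vec E_{b,\rm in}(v)$, $\vec E_{b,\rm out}(v)$ as usual; connected means the underlying undirected graph is connected. A Toom graph with $\sigma$ charges: vertex types $\{\circ,\ast,1,\dots,\sigma\}$, edge types $\{1,\dots,\sigma\}$, with (i) $v\in V_\circ$: no incoming edges and $|\vec E_{1,\rm out}(v)|=\dots=|\vec E_{\sigma,\rm out}(v)|\le1$; (ii) $v\in V_\ast$: no outgoing edges and $|\vec E_{1,\rm in}(v)|=\dots=|\vec E_{\sigma,\rm in}(v)|\le1$; (iii) $v\in V_s$: exactly one incoming and one outgoing edge of charge $s$ and none of other charges. A rooted Toom graph is a triple $(v_\circ,\mathcal V,\mathcal E)$ with $v_\circ\in V_\circ$. The trivial Toom graph: $V_\circ=V_\ast=\{0\}$, no other vertices, no edges. An incomplete Toom graph with $\sigma\ge2$ charges: connected typed directed graph with these type sets, vertex set $\{0,\dots,N\}$, $0\in V_\circ$, such that (i) $v\in V_\circ$: no incoming edges, at most one outgoing edge of each charge; (ii) $v\in V_\ast$: no outgoing edges, at most one incoming of each charge; (iii) $v\in V_s$: at most one incoming and at most one outgoing edge of charge $s$, none of other charges; and either it is the trivial Toom graph or (iv) every $v\in(V_\sigma\cup V_\circ)\setminus\{0\}$ has exactly one outgoing edge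 of charge $\sigma$; (v) every $v\in V_s$ with $1\le s<\sigma$ has exactly one incoming edge of charge $s$; (vi) every $v\in V_\ast$ has an incoming edge of some charge $1\le s<\sigma$. The trivial incomplete Toom graph has $V=V_\circ=\{0\}$, $V_\ast=\emptyset$, $V_s=\emptyset$, no edges. A loose end is a pair $(v,s)$ with either $v\in V_\circ\cup V_s$, $1\le s<\sigma$, and no outgoing edge of charge $s$ at $v$; or $v\in V_\ast\cup V_\sigma$, $s=\sigma$, and no incoming edge of charge $\sigma$ at $v$. The most urgent loose end is the one with the smallest charge $s$ and, among those, the smallest vertex $v$. An extension of an incomplete Toom graph $(\mathcal V,\mathcal E)$ at a loose end $(v,s)$ is an incomplete Toom graph $(\mathcal V',\mathcal E')$ with $\mathcal V\subset\mathcal V'$, $\mathcal E\subset\mathcal E'$ and $\mathcal E'\setminus\mathcal E$ a single element, of the form $(v,w,s)$ if $s<\sigma$ and $(w,v,\sigma)$ if $s=\sigma$. *)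

(* Defs.v *)
From mathcomp Require Import all_boot.
Set Implicit Arguments. Unset Strict Implicit. Unset Printing Implicit Defensive.

(* Vertex types: circ (source), star (sink), and charges s (meaningful for 1 <= s <= sigma). *)
Inductive vtype := VCirc | VStar | VChg of nat.

(* A typed directed graph whose vertices live in a universe U:
   vt v a  <=> (v,a) is in the vertex-type set;
   ed v w s <=> (v,w,s) is a directed edge from v to w of type (charge) s.
   The vertex set is the set of elements having at least one type. *)
Record tgraph (U : Type) := TGraph { vt : U -> vtype -> bool ; ed : U -> U -> nat -> bool }.

Section Defs.
Variable sigma : nat.

Definition isv (U : Type) (G : tgraph U) (v : U) : Prop := exists a, vt G v a.

Definition wf_tg (U : Type) (G : tgraph U) : Prop :=
  (forall v s, vt G v (VChg s) -> 0 < s <= sigma) /\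
  (forall v w s, ed G v w s -> [/\ isv G v, isv G w & 0 < s <= sigma]).

Definition outE (U : finType) (G : tgraph U) (s : nat) (v : U) := [set w | ed G v w s].
Definition inE_ (U : finType) (G : tgraph U) (s : nat) (v : U) := [set w | ed G w v s].

Definition tconnected (U : finType) (G : tgraph U) : Prop :=
  forall u w, isv G u -> isv G w ->
    connect [rel x y | [exists s : 'I_sigma.+1, ed G x y s || ed G y x s]] u w.

Definition toom (U : finType) (G : tgraph U) : Prop :=
  wf_tg G /\
  (forall v, vt G v VCirc ->
     (forall w s, ~~ ed G w v s) /\
     exists2 k, k <= 1 & forall s, 0 < s <= sigma -> #|outE G s v| = k) /\
  (forall v, vt G v VStar ->
     (forall w s, ~~ ed G v w s) /\
     exists2 k, k <= 1 & forall s, 0 < s <= sigma -> #|inE_ G s v| = k) /\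
  (forall v s, vt G v (VChg s) ->
     [/\ #|inE_ G s v| = 1, #|outE G s v| = 1 &
         forall t, t != s -> #|inE_ G t v| = 0 /\ #|outE G t v| = 0]).

Definition trivial_at (U : Type) (G : tgraph U) (v0 : U) : Prop :=
  (forall v, isv G v -> v = v0) /\ vt G v0 VCirc /\ vt G v0 VStar /\
  (forall a, vt G v0 a -> a = VCirc \/ a = VStar) /\
  (forall v w s, ~~ ed G v w s).

Definition incomplete (n : nat) (G : tgraph 'I_n.+1) : Prop :=
  wf_tg G /\
  (exists N', forall i : 'I_n.+1, isv G i <-> (i <= N')%N) /\
  tconnected G /\
  vt G ord0 VCirc /\
  (forall v, vt G v VCirc ->
     (forall w s, ~~ ed G w v s) /\ forall s, #|outE G s v| <= 1) /\
  (forall v, vt G v VStar ->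
     (forall w s, ~~ ed G v w s) /\ forall s, #|inE_ G s v| <= 1) /\
  (forall v s, vt G v (VChg s) ->
     [/\ #|inE_ G s v| <= 1, #|outE G s v| <= 1 &
         forall t, t != s -> #|inE_ G t v| = 0 /\ #|outE G t v| = 0]) /\
  (trivial_at G ord0 \/
   [/\ (forall v, vt G v (VChg sigma) || vt G v VCirc -> v != ord0 ->
          #|outE G sigma v| = 1),
       (forall v s, 0 < s < sigma -> vt G v (VChg s) -> #|inE_ G s v| = 1) &
       (forall v, vt G v VStar -> exists s, 0 < s < sigma /\ exists w, ed G w v s)]).

Definition loose_end (n : nat) (G : tgraph 'I_n.+1) (v : 'I_n.+1) (s : nat) : Prop :=
  ((vt G v VCirc \/ vt G v (VChg s)) /\ 0 < s < sigma /\ (forall w, ~~ ed G v w s)) \/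
  ((vt G v VStar \/ vt G v (VChg sigma)) /\ s = sigma /\ (forall w, ~~ ed G w v sigma)).

Definition most_urgent (n : nat) (G : tgraph 'I_n.+1) (v : 'I_n.+1) (s : nat) : Prop :=
  loose_end G v s /\
  forall v' s', loose_end G v' s' -> (s < s')%N \/ (s = s' /\ (v <= v')%N).

Definition extension (n : nat) (G G' : tgraph 'I_n.+1) (v : 'I_n.+1) (s : nat) : Prop :=
  incomplete G' /\
  (forall u a, vt G u a -> vt G' u a) /\
  exists w : 'I_n.+1,
    let e := if (s < sigma)%N then (v, w, s) else (w, v, sigma) in
    ~~ ed G e.1.1 e.1.2 e.2 /\
    forall x y t, ed G' x y t = ed G x y t || ((x, y, t) == e).

Definition ext_most_urgent (n : nat) (G G' : tgraph 'I_n.+1) : Prop :=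
  exists v s, most_urgent G v s /\ extension G G' v s.

Definition trivial_incomplete (n : nat) (G : tgraph 'I_n.+1) : Prop :=
  (forall v a, vt G v a <-> v = ord0 /\ a = VCirc) /\
  (forall v w s, ~~ ed G v w s).

Definition edge_count (U : finType) (G : tgraph U) : nat :=
  #|[set x : U * U * 'I_sigma.+1 | ed G x.1.1 x.1.2 x.2]|.

End Defs.

(* relabel a graph on 'I_m by eta^{-1}: vertex u becomes eta^{-1} u, so
   (v,a) is in the relabelled vertex-type set iff (eta v, a) is in the original *)
Definition relabel (T : Type) (m : nat) (eta : T -> 'I_m) (G : tgraph 'I_m) : tgraph T :=
  TGraph (fun v a => vt G (eta v) a) (fun v w s => ed G (eta v) (eta w) s).

Definition tg_eq (T : Type) (G H : tgraph T) : Prop :=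
  (forall v a, vt G v a = vt H v a) /\ (forall v w s, ed G v w s = ed H v w s).

(* Main.v *)
Require Import Defs.
From mathcomp Require Import all_boot zify.
From Stdlib Require Import Classical FunctionalExtensionality Wf_nat.
Set Implicit Arguments. Unset Strict Implicit. Unset Printing Implicit Defensive.

(* Explore G from its root one edge at a time, keeping an injective labelling of the
   explored part by an initial segment of {0,...,N} that preserves types and edges.
   While an edge of G is unexplored there is a loose end: otherwise double counting
   the edges of each charge (charge 1 and charge sigma, using sigma >= 2 at the root)
   shows that every edge of G at an explored vertex is explored, and connectivity makes
   the exploration complete.  A Toom graph has at most one edge of each charge in each
   direction at a vertex, so the edge of G at the most urgent loose end is determined;
   its other endpoint keeps its label or receives the next free one.  Hence every step,
   and with it the labelling, is forced, which gives uniqueness. *)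


Lemma connect_isolated (U : finType) (r : rel U) x y :
  (forall z, ~~ r x z) -> connect r x y -> y = x.
Proof.
move=> isol /connectP [[|z p] /=]; first by move=> _ ->.
by rewrite (negbTE (isol z)).
Qed.

Lemma tg_eqP (U : Type) (H1 H2 : tgraph U) : tg_eq H1 H2 -> H1 = H2.
Proof.
case: H1 H2 => [vt1 ed1] [vt2 ed2] [/= E1 E2]; f_equal.
- by do 2 apply: functional_extensionality => ?; apply: E1.
- by do 3 apply: functional_extensionality => ?; apply: E2.
Qed.

Lemma card_set_sum (U : finType) (P : pred U) : #|[set x | P x]| = \sum_x P x.
Proof.
rewrite cardsE -sum1_card big_mkcond /=; apply: eq_bigr => x _.
by rewrite unfold_in; case: (P x).
Qed.

Lemma sum_out_in (U : finType) (H : tgraph U) t :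
  \sum_x #|outE H t x| = \sum_x #|inE_ H t x|.
Proof.
under eq_bigr => x _ do rewrite card_set_sum.
under [RHS]eq_bigr => x _ do rewrite card_set_sum.
exact: exchange_big.
Qed.

Lemma ltn_sum_at (U : finType) (f h : U -> nat) x0 :
  (forall x, f x <= h x) -> f x0 < h x0 -> \sum_x f x < \sum_x h x.
Proof.
move=> le_fh lt_fh; rewrite (bigD1 x0) //= [ltnRHS](bigD1 x0) //= -addSn.
by apply: leq_add => //; apply: leq_sum => x _.
Qed.

Lemma ex_minn_classic (P : nat -> Prop) :
  (exists k, P k) -> exists2 k, P k & forall k', P k' -> k <= k'.
Proof.
move=> exP; have [k [[Pk minP] _]] :=
  dec_inh_nat_subset_has_unique_least_element P (fun k => classic (P k)) exP.
by exists k => // k' /minP /leP.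
Qed.

Section IncompleteGraphs.
Variable sigma : nat.

Definition adj (U : finType) (H : tgraph U) : rel U :=
  [rel x y | [exists s : 'I_sigma.+1, ed H x y s || ed H y x s]].

Definition edge_in (U : Type) (H : tgraph U) (e : U * U * nat) : bool :=
  ed H e.1.1 e.1.2 e.2.

Definition ext_edge (U : Type) (s : nat) (v w : U) : U * U * nat :=
  if s < sigma then (v, w, s) else (w, v, sigma).

Lemma adj_sym (U : finType) (H : tgraph U) : symmetric (adj H).
Proof. by move=> x y; apply/existsP/existsP => -[s hs]; exists s; rewrite orbC. Qed.

Lemma adj_of_edge (U : finType) (H : tgraph U) x y t :
  ed H x y t -> t <= sigma -> adj H x y.
Proof. by move=> exy t_le; apply/existsP; exists (inord t); rewrite /= inordK // exy. Qed.

Lemma tconnected_from (U : finType) (H : tgraph U) r :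
  (forall u, isv H u -> connect (adj H) r u) -> tconnected sigma H.
Proof.
move=> reach u w hu hw; apply: connect_trans (reach w hw).
by rewrite (sym_connect_sym (@adj_sym U H)); apply: reach.
Qed.

Lemma edge_count_add (U : finType) (H H' : tgraph U) (e : U * U * nat) :
  0 < e.2 <= sigma -> ~~ edge_in H e ->
  (forall x y t, ed H' x y t = ed H x y t || ((x, y, t) == e)) ->
  edge_count sigma H' = (edge_count sigma H).+1.
Proof.
case: e => -[a b] u /andP [_ u_le] /negbTE e_new edE; rewrite /edge_count.
have -> : [set x : U * U * 'I_sigma.+1 | ed H' x.1.1 x.1.2 x.2] =
          (a, b, inord u) |: [set x : U * U * 'I_sigma.+1 | ed H x.1.1 x.1.2 x.2].
  apply/setP => -[[i j] t]; rewrite !inE /= edE orbC; congr (_ || _).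
  apply/eqP/eqP => [[-> -> <-]|[-> -> ->]]; first by rewrite inord_val.
  by rewrite inordK.
by rewrite cardsU1 inE /= inordK // -[ed H a b u]/(edge_in H (a, b, u)) e_new.
Qed.

Section Incomplete.
Variables (n : nat) (H : tgraph 'I_n.+1).
Hypothesis H_inc : incomplete sigma H.

Lemma incomplete_root : vt H ord0 VCirc.
Proof. by case: H_inc => _ [_ [_ []]]. Qed.

Lemma incomplete_range : exists N, forall i : 'I_n.+1, isv H i <-> i <= N.
Proof. by case: H_inc => _ []. Qed.

Lemma incomplete_edge_isv x y t : ed H x y t -> isv H x /\ isv H y.
Proof. by case: H_inc => -[_ wf] _ /wf []. Qed.

Lemma incomplete_connected : tconnected sigma H.
Proof. by case: H_inc => _ [_ []]. Qed.

End Incomplete.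

Section LooseEnds.
Variables (n : nat) (H : tgraph 'I_n.+1).

Lemma loose_end_isv v s : loose_end sigma H v s -> isv H v.
Proof. by case=> -[[h|h] _]; eexists; exact: h. Qed.

Lemma loose_end_free v s w : loose_end sigma H v s -> ~~ edge_in H (ext_edge s v w).
Proof.
rewrite /ext_edge; case=> -[_ [hs free]]; last by rewrite hs ltnn; apply: free.
by case/andP: hs => _ ->; apply: free.
Qed.

Lemma most_urgent_exists :
  (exists v s, loose_end sigma H v s) -> exists v s, most_urgent sigma H v s.
Proof.
move=> [v0 [s0 loose0]].
(* loose ends are ordered lexicographically by the rank s * n.+1 + v *)
pose rank k := exists v s, loose_end sigma H v s /\ k = s * n.+1 + v.
have [|_ [v [s [loose ->]]] minP] := @ex_minn_classic rank.
  by exists (s0 * n.+1 + v0), v0, s0.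
exists v, s; split => // v' s' loose'.
have /minP : rank (s' * n.+1 + v') by exists v', s'.
have := ltn_ord v; have := ltn_ord v'.
case: (ltngtP s s') => [lt|gt|->] ltv' ltv le; [by left| |by right; split => //; lia].
have : s' * n.+1 + n.+1 <= s * n.+1 by rewrite addnC -mulSn leq_mul2r gt orbT.
lia.
Qed.

Lemma most_urgent_uniq v s v' s' :
  most_urgent sigma H v s -> most_urgent sigma H v' s' -> v = v' /\ s = s'.
Proof.
move=> [loose min] [loose' min'].
have [lt|[Es le]] := min _ _ loose'; have [lt'|[Es' le']] := min' _ _ loose; try lia.
by split => //; apply: ord_inj; apply/eqP; rewrite eqn_leq le le'.
Qed.

End LooseEnds.

Section Extensions.
Variables (n : nat) (H H' : tgraph 'I_n.+1) (v w : 'I_n.+1) (s : nat).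
Hypotheses (H_inc : incomplete sigma H) (H'_inc : incomplete sigma H').
Hypothesis v_in : isv H v.
Hypothesis grow_vt : forall u a, vt H u a -> vt H' u a.
Hypothesis add_ed : forall x y t, ed H' x y t = ed H x y t || ((x, y, t) == ext_edge s v w).

Lemma extension_isv i : isv H' i <-> isv H i \/ i = w.
Proof.
have new_edge : edge_in H' (ext_edge s v w).
  by rewrite /edge_in add_ed -!surjective_pairing eqxx orbT.
split=> [hi|]; last first.
  case=> [[a h]|->]; first by exists a; apply: grow_vt.
  by move: new_edge; rewrite /ext_edge; case: ifP => _ /incomplete_edge_isv => /(_ H'_inc) [].
(* a vertex of H' outside H other than w would be isolated in H', yet H' is connected *)
case: (classic (isv H i)) => [|not_old]; first by left.
case: (classic (i = w)) => [|not_w]; first by right.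
have root_in : isv H' ord0 by exists VCirc; apply: grow_vt; apply: incomplete_root.
have isol : forall z, ~~ adj H' i z.
  move=> z; apply/existsP => -[t]; rewrite !add_ed /ext_edge.
  case: ifP => _ /orP [/orP [/incomplete_edge_isv-/(_ H_inc) []|/eqP [*]]|
                      /orP [/incomplete_edge_isv-/(_ H_inc) []|/eqP [*]]] //; by subst.
have root_eq := connect_isolated isol (incomplete_connected H'_inc hi root_in).
by case: not_old; rewrite -root_eq; exists VCirc; apply: incomplete_root.
Qed.

Lemma extension_fresh N : (forall i, isv H i <-> i <= N) -> ~ isv H w -> w = N.+1 :> nat.
Proof.
move=> rangeH w_new; have [N' rangeH'] := incomplete_range H'_inc.
have w_gt : N < w by rewrite ltnNge; apply/negP => /rangeH.
have w_le : w <= N' by apply/rangeH'/extension_isv; right.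
have lt_n : N.+1 < n.+1 := leq_ltn_trans w_gt (ltn_ord w).
have : isv H' (Ordinal lt_n) by apply/rangeH' => /=; lia.
by case/extension_isv => [/rangeH /=|<-//]; rewrite ltnn.
Qed.

End Extensions.
End IncompleteGraphs.

Section Exploration.
Variables (sigma : nat) (T : finType) (G : tgraph T) (vo : T).
Hypothesis sigma_gt1 : 1 < sigma.
Hypothesis G_typed : forall v, isv G v.
Hypothesis G_toom : toom sigma G.
Hypothesis vo_circ : vt G vo VCirc.
Hypothesis G_connected : tconnected sigma G.
Hypothesis G_nontrivial : ~ exists v0, trivial_at G v0.

Lemma edge_charge x y t : ed G x y t -> 0 < t <= sigma.
Proof. by case: G_toom => -[_ wf] _ /wf []. Qed.

Lemma vtype_charge x s : vt G x (VChg s) -> 0 < s <= sigma.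
Proof. by case: G_toom => -[wf _] _ /wf. Qed.

Lemma circ_local x : vt G x VCirc ->
  (forall w s, ~~ ed G w x s) /\
  exists2 k, k <= 1 & forall s, 0 < s <= sigma -> #|outE G s x| = k.
Proof. by case: G_toom => _ [loc _] /loc. Qed.

Lemma star_local x : vt G x VStar ->
  (forall w s, ~~ ed G x w s) /\
  exists2 k, k <= 1 & forall s, 0 < s <= sigma -> #|inE_ G s x| = k.
Proof. by case: G_toom => _ [_ [loc _]] /loc. Qed.

Lemma chg_local x s : vt G x (VChg s) ->
  [/\ #|inE_ G s x| = 1, #|outE G s x| = 1 &
      forall t, t != s -> #|inE_ G t x| = 0 /\ #|outE G t x| = 0].
Proof. by case: G_toom => _ [_ [_ loc]] /loc. Qed.

Lemma circ_no_in x : vt G x VCirc -> forall w s, ~~ ed G w x s.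
Proof. by case/circ_local. Qed.

Lemma star_no_out x : vt G x VStar -> forall w s, ~~ ed G x w s.
Proof. by case/star_local. Qed.

Lemma out_card_le1 x t : #|outE G t x| <= 1.
Proof.
have [[] ] := G_typed x.
- case/circ_local => _ [k k_le1 card_k].
  have [/card_k -> //|t_out] := boolP (0 < t <= sigma).
  by rewrite eq_card0 // => y; rewrite !inE; apply: contraNF t_out => /edge_charge.
- by move/star_no_out => no_out; rewrite eq_card0 // => y; rewrite !inE (negbTE (no_out _ _)).
- move=> s /chg_local [_ card_s card_t]; have [->|/card_t [_ ->] //] := eqVneq t s.
  by rewrite card_s.
Qed.

Lemma in_card_le1 x t : #|inE_ G t x| <= 1.
Proof.
have [[] ] := G_typed x.
- by move/circ_no_in => no_in; rewrite eq_card0 // => y; rewrite !inE (negbTE (no_in _ _)).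
- case/star_local => _ [k k_le1 card_k].
  have [/card_k -> //|t_out] := boolP (0 < t <= sigma).
  by rewrite eq_card0 // => y; rewrite !inE; apply: contraNF t_out => /edge_charge.
- move=> s /chg_local [card_s _ card_t]; have [->|/card_t [-> _] //] := eqVneq t s.
  by rewrite card_s.
Qed.

Lemma out_uniq x y z t : ed G x y t -> ed G x z t -> y = z.
Proof.
by move=> exy exz; apply: (card_le1_eqP (out_card_le1 x t)); rewrite inE.
Qed.

Lemma in_uniq x y z t : ed G y x t -> ed G z x t -> y = z.
Proof.
by move=> eyx ezx; apply: (card_le1_eqP (in_card_le1 x t)); rewrite inE.
Qed.

Lemma edge_src x y t : ed G x y t -> vt G x VCirc \/ vt G x (VChg t).
Proof.
move=> exy; have [[] ] := G_typed x; first by left.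
- by move=> /star_no_out/(_ y t); rewrite exy.
- move=> s x_s; have [_ _ other] := chg_local x_s.
  have [->|/other [_ no_out]] := eqVneq t s; first by right.
  suff : 0 < #|outE G t x| by rewrite no_out.
  by apply/card_gt0P; exists y; rewrite inE.
Qed.

Lemma edge_tgt x y t : ed G x y t -> vt G y VStar \/ vt G y (VChg t).
Proof.
move=> exy; have [[] ] := G_typed y; last 1 first.
- move=> s y_s; have [_ _ other] := chg_local y_s.
  have [->|/other [no_in _]] := eqVneq t s; first by right.
  suff : 0 < #|inE_ G t y| by rewrite no_in.
  by apply/card_gt0P; exists x; rewrite inE.
- by move=> /circ_no_in/(_ x t); rewrite exy.
- by left.
Qed.

Lemma chg_in_ex x s : vt G x (VChg s) -> exists y, ed G y x s.
Proof.
case/chg_local => card_in _ _.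
have /card_gt0P [y] : 0 < #|inE_ G s x| by rewrite card_in.
by rewrite inE; exists y.
Qed.

Lemma chg_out_ex x s : vt G x (VChg s) -> exists y, ed G x y s.
Proof.
case/chg_local => _ card_out _.
have /card_gt0P [y] : 0 < #|outE G s x| by rewrite card_out.
by rewrite inE; exists y.
Qed.

Lemma root_vtype a : vt G vo a -> a = VCirc.
Proof.
have no_chg s : ~ vt G vo (VChg s).
  by case/chg_in_ex => y eyvo; move: (circ_no_in vo_circ y s); rewrite eyvo.
case: a => [//|vo_star|s /no_chg //].
(* a root that is both a source and a sink is isolated, so G would be trivial *)
case: G_nontrivial; exists vo.
have isol : forall z, ~~ adj sigma G vo z.
  move=> z; apply/existsP => -[s /orP [e|e]];
  [move: (star_no_out vo_star z s)|move: (circ_no_in vo_circ z s)]; by rewrite e.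
have all_vo v : v = vo by apply: connect_isolated isol (G_connected _ _).
split; [by move=> v _; apply: all_vo|split=> //; split=> //; split].
- by case=> [||s /no_chg]; [left|right|].
- by move=> v w s; rewrite (all_vo v); apply: star_no_out.
Qed.

Section HasEdge.
Hypothesis G_edge : exists x y t, ed G x y t.

Lemma incident_edge x : exists y t, ed G x y t \/ ed G y x t.
Proof.
have [a [b [t eab]]] := G_edge.
case/connectP: (G_connected (G_typed x) (G_typed a)) => -[/= _ Ea|z p /=].
  by exists b, t; left; rewrite -Ea.
by case/andP => /existsP [s /orP [e|e]] _ _; exists z, s; [left|right].
Qed.

Lemma vtype_uniq x a b : vt G x a -> vt G x b -> a = b.
Proof.
have circ_star : vt G x VCirc -> vt G x VStar -> False.
  move=> x_circ x_star; have [y [t [exy|eyx]]] := incident_edge x.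
  - by move: (star_no_out x_star y t); rewrite exy.
  - by move: (circ_no_in x_circ y t); rewrite eyx.
have circ_chg s : vt G x VCirc -> vt G x (VChg s) -> False.
  by move=> x_circ /chg_in_ex [y]; apply/negP/circ_no_in.
have star_chg s : vt G x VStar -> vt G x (VChg s) -> False.
  by move=> x_star /chg_out_ex [y]; apply/negP/star_no_out.
have chg_chg s s' : vt G x (VChg s) -> vt G x (VChg s') -> s = s'.
  move=> x_s x_s'; apply/eqP; rewrite eq_sym; apply: contraT => neq.
  have [_ _ /(_ _ neq) [in0 _]] := chg_local x_s.
  by have [] := chg_local x_s'; rewrite in0.
case: a => [||s] ha; case: b => [||s'] hb //;
  first [ by case: (circ_star ha hb) | by case: (circ_star hb ha)
        | by case: (circ_chg _ ha hb) | by case: (circ_chg _ hb ha)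
        | by case: (star_chg _ ha hb) | by case: (star_chg _ hb ha)
        | by rewrite (chg_chg _ _ ha hb) ].
Qed.

Lemma circ_out_ex x t : vt G x VCirc -> 0 < t <= sigma -> exists y, ed G x y t.
Proof.
move=> x_circ t_range; have [no_in [k _ card_k]] := circ_local x_circ.
suff : 0 < #|outE G t x| by case/card_gt0P => y; rewrite inE; exists y.
rewrite card_k //; have [y [t' [exy|eyx]]] := incident_edge x; last first.
  by move: (no_in y t'); rewrite eyx.
rewrite -(card_k _ (edge_charge exy)); apply/card_gt0P; exists y; by rewrite inE.
Qed.

Lemma star_in_ex x t : vt G x VStar -> 0 < t <= sigma -> exists y, ed G y x t.
Proof.
move=> x_star t_range; have [no_out [k _ card_k]] := star_local x_star.
suff : 0 < #|inE_ G t x| by case/card_gt0P => y; rewrite inE; exists y.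
rewrite card_k //; have [y [t' [exy|eyx]]] := incident_edge x.
  by move: (no_out y t'); rewrite exy.
rewrite -(card_k _ (edge_charge eyx)); apply/card_gt0P; exists y; by rewrite inE.
Qed.

End HasEdge.

Local Notation n := #|T|.-1.

Definition embed (H : tgraph 'I_n.+1) (g : 'I_n.+1 -> T) : Prop :=
 [/\ (forall i, isv H i -> forall a, vt H i a = vt G (g i) a),
     (forall i j t, ed H i j t -> [/\ isv H i, isv H j & ed G (g i) (g j) t]),
     (forall i j, isv H i -> isv H j -> g i = g j -> i = j) &
     g ord0 = vo].

Section Embedding.
Variables (H : tgraph 'I_n.+1) (g : 'I_n.+1 -> T).
Hypothesis g_embed : embed H g.

Lemma embed_vtE i a : isv H i -> vt H i a = vt G (g i) a.
Proof. by case: g_embed => vtE _ _ _ /vtE. Qed.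

Lemma embed_vt i a : vt H i a -> vt G (g i) a.
Proof. by move=> h; rewrite -embed_vtE //; exists a. Qed.

Lemma embed_ed i j t : ed H i j t -> ed G (g i) (g j) t.
Proof. by case: g_embed => _ edE _ _ /edE []. Qed.

Lemma embed_ed_isv i j t : ed H i j t -> isv H i /\ isv H j.
Proof. by case: g_embed => _ edE _ _ /edE []. Qed.

Lemma embed_inj i j : isv H i -> isv H j -> g i = g j -> i = j.
Proof. by case: g_embed => _ _ inj _; apply: inj. Qed.

Lemma embed_root : g ord0 = vo.
Proof. by case: g_embed. Qed.

Lemma embed_out_le1 t i : #|outE H t i| <= 1.
Proof.
apply/card_le1_eqP => j k; rewrite !inE => eij eik.
have [_ hj] := embed_ed_isv eij; have [_ hk] := embed_ed_isv eik.
by apply: embed_inj => //; apply: out_uniq (embed_ed eik) (embed_ed eij).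
Qed.

Lemma embed_in_le1 t i : #|inE_ H t i| <= 1.
Proof.
apply/card_le1_eqP => j k; rewrite !inE => eji eki.
have [hj _] := embed_ed_isv eji; have [hk _] := embed_ed_isv eki.
by apply: embed_inj => //; apply: in_uniq (embed_ed eki) (embed_ed eji).
Qed.

Lemma embed_wf : wf_tg sigma H.
Proof.
split=> [i s /embed_vt /vtype_charge //|i j t eij].
by have [hi hj] := embed_ed_isv eij; split=> //; apply: edge_charge (embed_ed eij).
Qed.

Lemma embed_local :
  (forall v, vt H v VCirc ->
     (forall w s, ~~ ed H w v s) /\ forall s, #|outE H s v| <= 1) /\
  (forall v, vt H v VStar ->
     (forall w s, ~~ ed H v w s) /\ forall s, #|inE_ H s v| <= 1) /\
  (forall v s, vt H v (VChg s) ->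
     [/\ #|inE_ H s v| <= 1, #|outE H s v| <= 1 &
         forall t, t != s -> #|inE_ H t v| = 0 /\ #|outE H t v| = 0]).
Proof.
split; [|split].
- move=> v /embed_vt /circ_no_in no_in; split=> [w s|s]; last exact: embed_out_le1.
  by apply: contraT => /negbNE /embed_ed; rewrite (negbTE (no_in _ _)).
- move=> v /embed_vt /star_no_out no_out; split=> [w s|s]; last exact: embed_in_le1.
  by apply: contraT => /negbNE /embed_ed; rewrite (negbTE (no_out _ _)).
move=> v s /embed_vt /chg_local [_ _ other]; split=> [||t /other [in0 out0]].
- exact: embed_in_le1.
- exact: embed_out_le1.
split; apply: eq_card0 => w; rewrite !inE; apply/negbTE/negP => /embed_ed e.
- suff : 0 < #|inE_ G t (g v)| by rewrite in0.
  by apply/card_gt0P; exists (g w); rewrite inE.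
- suff : 0 < #|outE G t (g v)| by rewrite out0.
  by apply/card_gt0P; exists (g w); rewrite inE.
Qed.

Let edges_H := [set x : 'I_n.+1 * 'I_n.+1 * 'I_sigma.+1 | ed H x.1.1 x.1.2 x.2].
Let edges_G := [set x : T * T * 'I_sigma.+1 | ed G x.1.1 x.1.2 x.2].
Let edge_map (x : 'I_n.+1 * 'I_n.+1 * 'I_sigma.+1) := (g x.1.1, g x.1.2, x.2).

Lemma edge_map_inj : {in edges_H &, injective edge_map}.
Proof.
move=> [[i j] t] [[i' j'] t']; rewrite !inE /= => eij eij' [gi gj ->].
have [hi hj] := embed_ed_isv eij; have [hi' hj'] := embed_ed_isv eij'.
by rewrite (embed_inj hi hi' gi) (embed_inj hj hj' gj).
Qed.

Lemma edge_map_sub : edge_map @: edges_H \subset edges_G.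
Proof.
apply/subsetP => x /imsetP [[[i j] t]]; rewrite inE /= => /embed_ed eij ->.
by rewrite inE.
Qed.

Lemma edge_count_le_onto :
  (forall y z t, ed G y z t -> exists i j, ed H i j t /\ g i = y /\ g j = z) ->
  edge_count sigma G <= edge_count sigma H.
Proof.
move=> onto; apply: leq_trans (leq_imset_card edge_map edges_H).
apply/subset_leq_card/subsetP => -[[y z] t]; rewrite inE /= => /onto [i [j [eij [<- <-]]]].
by apply/imsetP; exists (i, j, t); rewrite ?inE.
Qed.

Lemma embed_count_onto : edge_count sigma H = edge_count sigma G ->
  forall y z t, ed G y z t -> exists i j, ed H i j t /\ g i = y /\ g j = z.
Proof.
move=> count_eq y z t eyz; have t_le : t < sigma.+1 by have := edge_charge eyz; lia.
have : edge_map @: edges_H == edges_G.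
  rewrite eqEcard edge_map_sub (card_in_imset edge_map_inj).
  by move: count_eq; rewrite /edge_count /= => ->.
move/eqP => onto; have : (y, z, Ordinal t_le) \in edges_G by rewrite inE.
rewrite -onto => /imsetP [[[i j] t']]; rewrite inE /= => eij [-> -> Et].
by exists i, j; rewrite (_ : t = t') // -Et.
Qed.

Section Covering.
Hypothesis root_in : isv H ord0.
Hypothesis incident_covered : forall y z t, ed G y z t ->
  (exists i, isv H i /\ g i = y) \/ (exists j, isv H j /\ g j = z) ->
  exists i j, ed H i j t /\ g i = y /\ g j = z.

Lemma embed_onto x : exists i, isv H i /\ g i = x.
Proof.
have /connectP [p] := G_connected (G_typed vo) (G_typed x).
have : exists i, isv H i /\ g i = vo by exists ord0; rewrite embed_root.
elim: p vo => [|z p IH] y0 y0_covered /=; first by move=> _ ->.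
case/andP => /existsP [s /orP [e|e]] path_p last_p; apply: IH path_p last_p.
- have [i [j [eij [_ <-]]]] := incident_covered e (or_introl y0_covered).
  by exists j; split=> //; case: (embed_ed_isv eij).
- have [i [j [eij [<- _]]]] := incident_covered e (or_intror y0_covered).
  by exists i; split=> //; case: (embed_ed_isv eij).
Qed.

Lemma embed_onto_edges y z t : ed G y z t ->
  exists i j, ed H i j t /\ g i = y /\ g j = z.
Proof. by move=> eyz; apply: incident_covered eyz _; left; apply: embed_onto. Qed.

End Covering.

End Embedding.

Section Saturation.
Variables (H : tgraph 'I_n.+1) (g : 'I_n.+1 -> T).
Hypotheses (g_embed : embed H g) (H_inc : incomplete sigma H).
Hypothesis G_edge : exists x y t, ed G x y t.

Lemma embed_completion :
  [/\ (forall v, vt H v (VChg sigma) || vt H v VCirc -> v != ord0 ->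
          #|outE H sigma v| = 1),
      (forall v s, 0 < s < sigma -> vt H v (VChg s) -> #|inE_ H s v| = 1) &
      (forall v, vt H v VStar -> exists s, 0 < s < sigma /\ exists w, ed H w v s)].
Proof.
case: H_inc => _ [_ [_ [_ [_ [_ [_ [[_ [_ [root_star _]]]|//]]]]]]].
by have := embed_vt g_embed root_star; rewrite (embed_root g_embed) => /root_vtype.
Qed.

Lemma embed_vtype_uniq i a b : vt H i a -> vt H i b -> a = b.
Proof. by move=> /(embed_vt g_embed) ha /(embed_vt g_embed); apply: vtype_uniq. Qed.

Lemma out_card_le_types t i : #|outE H t i| <= vt H i VCirc + vt H i (VChg t).
Proof.
have [->//|/card_gt0P [w]] := posnP #|outE H t i|; rewrite inE => eiw.
have [hi _] := embed_ed_isv g_embed eiw.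
have le1 := embed_out_le1 g_embed t i.
by case: (edge_src (embed_ed g_embed eiw)); rewrite -(embed_vtE g_embed) // => ->; lia.
Qed.

Lemma in_card_le_types t i : #|inE_ H t i| <= vt H i VStar + vt H i (VChg t).
Proof.
have [->//|/card_gt0P [w]] := posnP #|inE_ H t i|; rewrite inE => ewi.
have [_ hi] := embed_ed_isv g_embed ewi.
have le1 := embed_in_le1 g_embed t i.
by case: (edge_tgt (embed_ed g_embed ewi)); rewrite -(embed_vtE g_embed) // => ->; lia.
Qed.

Let count_type a := \sum_(i : 'I_n.+1) (vt H i a : nat).

Lemma sum_out_le t : \sum_i #|outE H t i| <= count_type VCirc + count_type (VChg t).
Proof. by rewrite -big_split; apply: leq_sum => i _; apply: out_card_le_types. Qed.

Lemma sum_in_le t : \sum_i #|inE_ H t i| <= count_type VStar + count_type (VChg t).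
Proof. by rewrite -big_split; apply: leq_sum => i _; apply: in_card_le_types. Qed.

Section NoLooseEnd.
Hypothesis no_loose : forall v s, ~ loose_end sigma H v s.

Lemma out_edge_of_no_loose i t : 0 < t < sigma ->
  vt H i VCirc \/ vt H i (VChg t) -> exists w, ed H i w t.
Proof.
move=> t_range i_src; apply: NNPP => no_out.
apply: (no_loose (v := i) (s := t)); left; split=> //; split=> // w.
by apply/negP => eiw; apply: no_out; exists w.
Qed.

Lemma in_edge_of_no_loose i :
  vt H i VStar \/ vt H i (VChg sigma) -> exists w, ed H w i sigma.
Proof.
move=> i_tgt; apply: NNPP => no_in.
apply: (no_loose (v := i) (s := sigma)); right; split=> //; split=> // w.
by apply/negP => ewi; apply: no_in; exists w.
Qed.

Lemma sum_out_eq t : 0 < t < sigma ->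
  \sum_i #|outE H t i| = count_type VCirc + count_type (VChg t).
Proof.
move=> t_range; rewrite -big_split; apply: eq_bigr => i _; apply/eqP.
rewrite eqn_leq out_card_le_types /=.
have [i_circ|_] := boolP (vt H i VCirc); have [i_t|_] := boolP (vt H i (VChg t)) => //=.
- by have := embed_vtype_uniq i_circ i_t.
- have [w eiw] := out_edge_of_no_loose t_range (or_introl i_circ).
  by apply/card_gt0P; exists w; rewrite inE.
- have [w eiw] := out_edge_of_no_loose t_range (or_intror i_t).
  by apply/card_gt0P; exists w; rewrite inE.
Qed.

Lemma sum_in_sigma : \sum_i #|inE_ H sigma i| = count_type VStar + count_type (VChg sigma).
Proof.
rewrite -big_split; apply: eq_bigr => i _; apply/eqP.
rewrite eqn_leq in_card_le_types /=.
have [i_star|_] := boolP (vt H i VStar); have [i_s|_] := boolP (vt H i (VChg sigma)) => //=.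
- by have := embed_vtype_uniq i_star i_s.
- have [w ewi] := in_edge_of_no_loose (or_introl i_star).
  by apply/card_gt0P; exists w; rewrite inE.
- have [w ewi] := in_edge_of_no_loose (or_intror i_s).
  by apply/card_gt0P; exists w; rewrite inE.
Qed.

(* double counting the edges of charge sigma *)
Lemma stars_le_circs : count_type VStar <= count_type VCirc.
Proof.
by have := sum_out_le sigma; rewrite (sum_out_in H sigma) sum_in_sigma leq_add2r.
Qed.

Lemma no_loose_star_in j t : 0 < t < sigma -> vt H j VStar -> exists w, ed H w j t.
Proof.
move=> t_range j_star; apply: NNPP => no_in.
have : \sum_i #|inE_ H t i| < count_type VStar + count_type (VChg t).
  rewrite -big_split; apply: (ltn_sum_at (x0 := j)) => [i|]; first exact: in_card_le_types.
  rewrite j_star eq_card0 // => w; rewrite !inE.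
  by apply/negP => ewj; apply: no_in; exists w.
rewrite -(sum_out_in H t) sum_out_eq // ltn_add2r ltnNge.
by rewrite stars_le_circs.
Qed.

Lemma no_loose_root_out : exists w, ed H ord0 w sigma.
Proof.
apply: NNPP => no_out.
(* charge 1 gives count_type VCirc <= count_type VStar, and then charge sigma
   is short of one edge *)
have one_range : 0 < 1 < sigma by lia.
have := sum_in_le 1; rewrite -(sum_out_in H 1) sum_out_eq // leq_add2r => circs_le_stars.
have : \sum_i #|outE H sigma i| < count_type VCirc + count_type (VChg sigma).
  rewrite -big_split; apply: (ltn_sum_at (x0 := ord0)) => [i|]; first exact: out_card_le_types.
  rewrite (incomplete_root H_inc) eq_card0 // => w; rewrite !inE.
  by apply/negP => e0w; apply: no_out; exists w.
by rewrite (sum_out_in H sigma) sum_in_sigma; lia.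
Qed.

Lemma no_loose_lift_out i z t :
  isv H i -> ed G (g i) z t -> exists j, ed H i j t /\ g j = z.
Proof.
move=> hi e; suff [j eij] : exists j, ed H i j t.
  by exists j; split=> //; apply: out_uniq (embed_ed g_embed eij) e.
have i_src : vt H i VCirc \/ vt H i (VChg t).
  by case: (edge_src e); rewrite -(embed_vtE g_embed) //; [left|right].
have /andP [t_pos t_le] := edge_charge e.
have [t_lt|t_ge] := ltnP t sigma; first by apply: out_edge_of_no_loose; rewrite ?t_pos.
have t_sigma : t = sigma by apply/eqP; rewrite eqn_leq t_le.
rewrite t_sigma in i_src *.
have [->|i_ne0] := eqVneq i ord0; first exact: no_loose_root_out.
have [out_sigma _ _] := embed_completion.
have : 0 < #|outE H sigma i| by rewrite out_sigma //; case: i_src => ->; rewrite ?orbT.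
by case/card_gt0P => j; rewrite inE; exists j.
Qed.

Lemma no_loose_lift_in j y t :
  isv H j -> ed G y (g j) t -> exists i, ed H i j t /\ g i = y.
Proof.
move=> hj e; suff [i eij] : exists i, ed H i j t.
  by exists i; split=> //; apply: in_uniq (embed_ed g_embed eij) e.
have j_tgt : vt H j VStar \/ vt H j (VChg t).
  by case: (edge_tgt e); rewrite -(embed_vtE g_embed) //; [left|right].
have /andP [t_pos t_le] := edge_charge e.
have [t_lt|t_ge] := ltnP t sigma; last first.
  have t_sigma : t = sigma by apply/eqP; rewrite eqn_leq t_le.
  by rewrite t_sigma in j_tgt *; apply: in_edge_of_no_loose.
have t_range : 0 < t < sigma by rewrite t_pos.
case: j_tgt => [j_star|j_t]; first exact: no_loose_star_in.
have [_ in_chg _] := embed_completion.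
have : 0 < #|inE_ H t j| by rewrite in_chg.
by case/card_gt0P => i; rewrite inE; exists i.
Qed.

Lemma no_loose_count_ge : edge_count sigma G <= edge_count sigma H.
Proof.
apply: edge_count_le_onto => y z t eyz.
apply: (embed_onto_edges g_embed _ _ eyz) => [|{eyz}y {}z {}t e [[i [hi gi]]|[j [hj gj]]]].
- by exists VCirc; apply: incomplete_root H_inc.
- by rewrite -gi in e *; have [j [eij <-]] := no_loose_lift_out hi e; exists i, j.
- by rewrite -gj in e *; have [i [eij <-]] := no_loose_lift_in hj e; exists i, j.
Qed.

End NoLooseEnd.

Lemma loose_end_exists : edge_count sigma H < edge_count sigma G ->
  exists v s, loose_end sigma H v s.
Proof.
move=> lt_count; apply: NNPP => no_loose.
have := no_loose_count_ge (fun v s l => no_loose (ex_intro _ v (ex_intro _ s l))).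
by rewrite leqNgt lt_count.
Qed.

End Saturation.

Definition extend_graph (H : tgraph 'I_n.+1) (w : 'I_n.+1) (y : T)
    (e : 'I_n.+1 * 'I_n.+1 * nat) : tgraph 'I_n.+1 :=
  TGraph (fun i a => vt H i a || ((i == w) && vt G y a))
         (fun i j t => ed H i j t || ((i, j, t) == e)).

Definition extend_map (g : 'I_n.+1 -> T) (w : 'I_n.+1) (y : T) : 'I_n.+1 -> T :=
  fun i => if i == w then y else g i.

Section Extend.
Variables (H : tgraph 'I_n.+1) (g : 'I_n.+1 -> T).
Hypotheses (g_embed : embed H g) (H_inc : incomplete sigma H).
Hypothesis G_edge : exists x y t, ed G x y t.
Variable N : nat.
Hypothesis H_range : forall i : 'I_n.+1, isv H i <-> i <= N.
Variables (v w : 'I_n.+1) (y : T) (s : nat).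
Hypothesis v_in : isv H v.
Hypothesis w_old : isv H w -> g w = y.
Hypothesis w_new : ~ isv H w -> w = N.+1 :> nat /\ forall i, isv H i -> g i <> y.
Hypothesis edge_G : edge_in G (ext_edge sigma s (g v) y).
Hypothesis edge_new : ~~ edge_in H (ext_edge sigma s v w).

Local Notation e := (ext_edge sigma s v w).
Local Notation H' := (extend_graph H w y e).
Local Notation g' := (extend_map g w y).

Lemma ext_isv i : isv H' i <-> isv H i \/ i = w.
Proof.
split=> [[a /orP [h|/andP [/eqP -> _]]]|[[a h]|->]]; [by left; exists a|by right| |].
- by exists a; rewrite /= h.
- by have [a h] := G_typed y; exists a; rewrite /= eqxx h orbT.
Qed.

Lemma ext_map_old i : isv H i -> g' i = g i.
Proof. by rewrite /extend_map; case: eqVneq => [-> /w_old|]. Qed.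

Lemma ext_map_new : g' w = y.
Proof. by rewrite /extend_map eqxx. Qed.

Lemma ext_vt_old i a : isv H i -> vt H' i a = vt H i a.
Proof.
move=> hi /=; case: eqVneq => [Ei|_]; last by rewrite orbF.
have gi : g i = y by rewrite Ei; apply: w_old; rewrite -Ei.
by rewrite (embed_vtE g_embed) // gi orbb.
Qed.

Lemma ext_vt_new a : ~ isv H w -> vt H' w a = vt G y a.
Proof.
move=> w_out /=; rewrite eqxx /=.
by case: (boolP (vt H w a)) => // h; case: w_out; exists a.
Qed.

Lemma ext_edge_in : edge_in H' e.
Proof. by rewrite /edge_in /= -!surjective_pairing eqxx orbT. Qed.

Lemma ext_edge_G : ed G (g' e.1.1) (g' e.1.2) e.2.
Proof.
move: edge_G; rewrite /ext_edge /edge_in.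
by case: ifP => _ /=; rewrite (ext_map_old v_in) ext_map_new.
Qed.

Lemma ext_edge_isv : isv H' e.1.1 /\ isv H' e.1.2.
Proof.
have [hv hw] : isv H' v /\ isv H' w by split; apply/ext_isv; [left|right].
by rewrite /ext_edge; case: ifP.
Qed.

Lemma ext_embed : embed H' g'.
Proof.
split.
- move=> i i_in a; have [hi|hi] := classic (isv H i).
    by rewrite ext_vt_old // ext_map_old // (embed_vtE g_embed).
  have Ei : i = w by case/ext_isv: i_in.
  by subst i; rewrite ext_vt_new // ext_map_new.
- move=> i j t /orP [eij|/eqP Ee].
  + have [hi hj] := embed_ed_isv g_embed eij.
    rewrite (ext_map_old hi) (ext_map_old hj).
    by split; [apply/ext_isv; left|apply/ext_isv; left|apply: (embed_ed g_embed eij)].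
  + by have [] := ext_edge_isv; have := ext_edge_G; rewrite -Ee.
- move=> i j /ext_isv hi /ext_isv hj.
  have [hHi|hHi] := classic (isv H i); have [hHj|hHj] := classic (isv H j).
  + by rewrite !ext_map_old //; exact: (embed_inj g_embed hHi hHj).
  + have Ej : j = w by case: hj.
    subst j.
    by rewrite (ext_map_old hHi) ext_map_new => /(proj2 (w_new hHj) _ hHi).
  + have Ei : i = w by case: hi.
    subst i.
    by rewrite (ext_map_old hHj) ext_map_new => /esym/(proj2 (w_new hHi) _ hHj).
  + by case: hi => // ->; case: hj.
- have root_in : isv H ord0 by exists VCirc; apply: incomplete_root H_inc.
  by rewrite (ext_map_old root_in) (embed_root g_embed).
Qed.

Lemma ext_count : edge_count sigma H' = (edge_count sigma H).+1.
Proof. exact: edge_count_add (edge_charge ext_edge_G) edge_new _. Qed.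

Lemma ext_range : exists N', forall i : 'I_n.+1, isv H' i <-> i <= N'.
Proof.
have [w_in|w_out] := classic (isv H w).
  by exists N => i; rewrite ext_isv H_range; split=> [[//|->]|]; [apply/H_range|left].
have [w_N _] := w_new w_out.
exists N.+1 => i; rewrite ext_isv H_range; split=> [[|->]|i_le]; rewrite ?w_N; try lia.
by have [|i_gt] := leqP i N; [left|right; apply: ord_inj; lia].
Qed.

Lemma ext_connected : tconnected sigma H'.
Proof.
have root_in : isv H ord0 by exists VCirc; apply: incomplete_root H_inc.
have old_reach x : isv H x -> connect (adj sigma H') ord0 x.
  move=> hx; apply: connect_sub (incomplete_connected H_inc root_in hx) => a b /existsP [t ab].
  by apply/connect1/existsP; exists t; case/orP: ab => h; rewrite /= h ?orbT.
apply: tconnected_from => u /ext_isv [|->]; first exact: old_reach.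
apply: connect_trans (old_reach _ v_in) (connect1 _).
have /andP [_ e_le] := edge_charge ext_edge_G.
move: (adj_of_edge ext_edge_in e_le); rewrite /ext_edge.
by case: ifP => _ //=; rewrite adj_sym.
Qed.

(* the conditions (iv)-(vi) at w, read off the type of its image y *)
Lemma ext_new_local :
  [/\ vt G y (VChg sigma) || vt G y VCirc -> exists z, ed H' w z sigma,
      forall s', 0 < s' < sigma -> vt G y (VChg s') -> exists z, ed H' z w s' &
      vt G y VStar -> exists s', 0 < s' < sigma /\ exists z, ed H' z w s'].
Proof.
have e_in := ext_edge_in; move: edge_G e_in; rewrite /edge_in /ext_edge.
have type_uniq := vtype_uniq G_edge.
case: ifP => s_lt /= eG e_in.
- have /andP [s_pos _] := edge_charge eG.
  case: (edge_tgt eG) => y_type; split.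
  + by case/orP => /type_uniq/(_ y_type).
  + by move=> s' _ /type_uniq/(_ y_type).
  + by move=> _; exists s; split; [rewrite s_pos|exists v].
  + case/orP => /type_uniq/(_ y_type) // [Es].
    by move: s_lt; rewrite Es ltnn.
  + by move=> s' _ /type_uniq/(_ y_type) [->]; exists v.
  + by move/type_uniq/(_ y_type).
- case: (edge_src eG) => y_type; split; try by exists v.
  + by move=> s' _ /type_uniq/(_ y_type).
  + by move/type_uniq/(_ y_type).
  + move=> s' /andP [_ s'_lt] /type_uniq/(_ y_type) [Es'].
    by move: s'_lt; rewrite Es' ltnn.
  + by move/type_uniq/(_ y_type).
Qed.

Lemma ext_completion :
  [/\ (forall u, vt H' u (VChg sigma) || vt H' u VCirc -> u != ord0 ->
          #|outE H' sigma u| = 1),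
      (forall u s', 0 < s' < sigma -> vt H' u (VChg s') -> #|inE_ H' s' u| = 1) &
      (forall u, vt H' u VStar -> exists s', 0 < s' < sigma /\ exists z, ed H' z u s')].
Proof.
have [out_sigma in_chg star_in] := embed_completion g_embed H_inc.
have grow_out t u : #|outE H t u| <= #|outE H' t u|.
  by apply/subset_leq_card/subsetP => z; rewrite !inE /= => ->.
have grow_in t u : #|inE_ H t u| <= #|inE_ H' t u|.
  by apply/subset_leq_card/subsetP => z; rewrite !inE /= => ->.
have old_or_new u a : vt H' u a -> isv H u \/ (u = w /\ ~ isv H w).
  move=> hu; have [u_in|u_out] := classic (isv H u); first by left.
  have /ext_isv [//|Eu] : isv H' u by exists a.
  by right; rewrite -Eu.
split.
- move=> u u_src u_ne0; apply/eqP; rewrite eqn_leq (embed_out_le1 ext_embed) /=.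
  have [a hu] : exists a, vt H' u a by case/orP: u_src => h; eexists; exact: h.
  have [u_in|[Eu w_out]] := old_or_new u _ hu.
  + rewrite !ext_vt_old // in u_src.
    by apply: leq_trans (grow_out _ _); rewrite out_sigma.
  + rewrite Eu !ext_vt_new // in u_src *; have [/(_ u_src) [z ewz] _ _] := ext_new_local.
    by apply/card_gt0P; exists z; rewrite inE.
- move=> u s' s'_range u_s; apply/eqP; rewrite eqn_leq (embed_in_le1 ext_embed) /=.
  have [u_in|[Eu w_out]] := old_or_new u _ u_s.
  + by rewrite ext_vt_old // in u_s; apply: leq_trans (grow_in _ _); rewrite in_chg.
  + rewrite Eu ext_vt_new // in u_s *.
    have [_ /(_ s' s'_range u_s) [z ezw] _] := ext_new_local.
    by apply/card_gt0P; exists z; rewrite inE.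
- move=> u u_star; have [u_in|[Eu w_out]] := old_or_new u _ u_star.
  + rewrite ext_vt_old // in u_star; have [s' [s'_range [z ezu]]] := star_in u u_star.
    by exists s'; split=> //; exists z; rewrite /= ezu.
  + by rewrite Eu ext_vt_new // in u_star *; have [_ _ /(_ u_star)] := ext_new_local.
Qed.

Lemma ext_incomplete : incomplete sigma H'.
Proof.
have [circ_loc [star_loc chg_loc]] := embed_local ext_embed.
split; first exact: embed_wf ext_embed.
split; first exact: ext_range.
split; first exact: ext_connected.
split; first by rewrite /= (incomplete_root H_inc).
by do 3 (split=> //); right; apply: ext_completion.
Qed.

Lemma ext_extension : extension sigma H H' v s.
Proof.
split; first exact: ext_incomplete.
by split=> [u a /= ->//|]; exists w.
Qed.

End Extend.

Lemma card_T : #|T| = n.+1.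
Proof. by rewrite prednK //; apply/card_gt0P; exists vo. Qed.

Section Labels.
Variables (H : tgraph 'I_n.+1) (g : 'I_n.+1 -> T) (N : nat).
Hypothesis g_embed : embed H g.
Hypothesis H_range : forall i : 'I_n.+1, isv H i <-> i <= N.

Lemma embed_onto_full : (forall x, exists i, isv H i /\ g i = x) -> forall i, isv H i.
Proof.
move=> onto i; apply/H_range; have [n_le|N_lt] := leqP n N.
  by apply: leq_trans n_le; rewrite -ltnS.
have small : #|[set i : 'I_n.+1 | i <= N]| < n.+1.
  rewrite -[X in _ < X]card_ord; apply: proper_card; apply/properP; split; first exact/subsetP.
  by exists ord_max; rewrite // inE /= -ltnNge.
have : #|T| <= #|[set i : 'I_n.+1 | i <= N]|.
  apply: leq_trans (leq_imset_card g _); rewrite -[X in X <= _]cardsT.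
  apply/subset_leq_card/subsetP => x _; have [j [hj <-]] := onto x.
  by apply: imset_f; rewrite inE; apply/H_range.
by rewrite [X in X <= _]card_T leqNgt small.
Qed.

Lemma embed_full_onto : n <= N -> forall x, exists i, isv H i /\ g i = x.
Proof.
move=> n_le x; have all_in i : isv H i by apply/H_range; apply: leq_trans n_le; rewrite -ltnS.
have g_inj : injective g.
  by move=> i j; apply: (embed_inj g_embed (all_in i) (all_in j)).
have card_le : #|T| <= #|'I_n.+1| by rewrite card_ord card_T.
by have /codomP [i ->] := inj_card_onto g_inj card_le x; exists i.
Qed.

Lemma attach_vertex y : exists w : 'I_n.+1,
  (isv H w -> g w = y) /\ (~ isv H w -> w = N.+1 :> nat /\ forall i, isv H i -> g i <> y).
Proof.
have [[i [hi gi]]|fresh] := classic (exists i, isv H i /\ g i = y).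
  by exists i; split=> // /(_ hi).
have N_lt : N < n by rewrite ltnNge; apply/negP => /embed_full_onto/(_ y).
have fresh' i : isv H i -> g i <> y by move=> hi gi; apply: fresh; exists i.
exists (Ordinal (N_lt : N.+1 < n.+1)); split=> [/H_range /=|]; first by rewrite ltnn.
by split.
Qed.
End Labels.

Lemma loose_end_edge H g v s : embed H g -> (exists x y t, ed G x y t) ->
  loose_end sigma H v s -> exists y, edge_in G (ext_edge sigma s (g v) y).
Proof.
move=> g_embed G_edge; rewrite /ext_edge /edge_in.
case=> -[v_type [s_range _]].
- have /andP [s_pos s_lt] := s_range; rewrite s_lt /=.
  have s_le : 0 < s <= sigma by rewrite s_pos ltnW.
  by case: v_type => /(embed_vt g_embed) v_type;
    [apply: circ_out_ex v_type s_le|apply: chg_out_ex v_type].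
- have s_le : 0 < sigma <= sigma by rewrite leqnn ltnW.
  rewrite s_range ltnn /=.
  by case: v_type => /(embed_vt g_embed) v_type;
    [apply: star_in_ex v_type s_le|apply: chg_in_ex v_type].
Qed.

Lemma exploration_step H g : embed H g -> incomplete sigma H ->
  edge_count sigma H < edge_count sigma G ->
  exists H' g', [/\ embed H' g', edge_count sigma H' = (edge_count sigma H).+1
                 & ext_most_urgent sigma H H'].
Proof.
move=> g_embed H_inc lt_count.
have G_edge : exists x y t, ed G x y t.
  have /card_gt0P [[[x y] t]] : 0 < edge_count sigma G by apply: leq_ltn_trans lt_count.
  by rewrite inE => e; exists x, y, t.
have [N H_range] := incomplete_range H_inc.
have [v [s urgent]] := most_urgent_exists (loose_end_exists g_embed H_inc G_edge lt_count).
have [loose _] := urgent.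
have [y edge_G] := loose_end_edge g_embed G_edge loose.
have [w [w_old w_new]] := attach_vertex g_embed H_range y.
have v_in := loose_end_isv loose; have edge_new := loose_end_free w loose.
exists (extend_graph H w y (ext_edge sigma s v w)), (extend_map g w y); split.
- exact: (ext_embed g_embed H_inc v_in w_old w_new edge_G).
- exact: (ext_count v_in w_old edge_G edge_new).
- exists v, s; split=> //.
  exact: (ext_extension g_embed H_inc G_edge H_range v_in w_old w_new edge_G edge_new).
Qed.

Definition root_graph : tgraph 'I_n.+1 :=
  TGraph (fun i a => (i == ord0) && (if a is VCirc then true else false)) (fun _ _ _ => false).

Lemma root_graph_isv i : isv root_graph i <-> i = ord0.
Proof. by split=> [[a /andP [/eqP]]|->] //; exists VCirc. Qed.

Lemma root_graph_embed : embed root_graph (fun _ => vo).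
Proof.
split=> // [i /root_graph_isv -> a|i j /root_graph_isv -> /root_graph_isv -> //].
by case: a => [||s] /=; rewrite ?vo_circ //; apply/esym/negP => /root_vtype.
Qed.

Lemma root_graph_incomplete : incomplete sigma root_graph.
Proof.
have [circ_loc [star_loc chg_loc]] := embed_local root_graph_embed.
split; first exact: embed_wf root_graph_embed.
split.
  by exists 0 => i; rewrite root_graph_isv leqn0; split=> [->|/eqP i0] //; apply: ord_inj.
split; first by apply: tconnected_from => u /root_graph_isv ->.
split=> //; do 3 (split=> //); right; split.
- by move=> u /orP [/andP [_ //]|/andP [/eqP -> _]]; rewrite eqxx.
- by move=> u s _ /andP [_ //].
- by move=> u /andP [_ //].
Qed.

Lemma root_graph_trivial : trivial_incomplete root_graph.
Proof. by split=> // i a; split=> [/andP [/eqP ->]|[-> ->] //]; case: a. Qed.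

Lemma exploration_prefix m : m <= edge_count sigma G ->
  exists (Gs : nat -> tgraph 'I_n.+1) g,
    [/\ embed (Gs m) g, edge_count sigma (Gs m) = m,
        (forall k, k <= m -> incomplete sigma (Gs k)),
        trivial_incomplete (Gs 0) &
        (forall k, 0 < k <= m -> ext_most_urgent sigma (Gs k.-1) (Gs k))].
Proof.
elim: m => [_|m IH lt_m].
  exists (fun _ => root_graph), (fun _ => vo); split=> //.
  - exact: root_graph_embed.
  - by apply: eq_card0 => x; rewrite inE.
  - by move=> k _; apply: root_graph_incomplete.
  - exact: root_graph_trivial.
  - by case=> [|k] /andP [].
have [Gs [g [g_embed count_m inc_Gs triv_Gs steps_Gs]]] := IH (ltnW lt_m).
have lt_count : edge_count sigma (Gs m) < edge_count sigma G by rewrite count_m.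
have [H' [g' [g'_embed count_H' urgent]]] :=
  exploration_step g_embed (inc_Gs m (leqnn m)) lt_count.
have [v [s [_ [H'_inc _]]]] := urgent.
exists (fun k => if k <= m then Gs k else H'), g'; split.
- by rewrite ltnn.
- by rewrite ltnn count_H' count_m.
- by move=> k _; case: ifP => [/inc_Gs|_].
- by [].
- move=> k /andP [k_pos k_le]; have [k_m|m_lt] := leqP k m.
    by rewrite /= (leq_trans (leq_pred k) k_m); apply: steps_Gs; rewrite k_pos.
  have -> : k = m.+1 by apply/eqP; rewrite eqn_leq k_le.
  by rewrite /= leqnn.
Qed.


Lemma ext_edge_uniq s x y y' :
  edge_in G (ext_edge sigma s x y) -> edge_in G (ext_edge sigma s x y') -> y = y'.
Proof. by rewrite /ext_edge /edge_in; case: ifP => _ /=; [apply: out_uniq|apply: in_uniq]. Qed.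

Definition exploration (eta : T -> 'I_n.+1) (Gs : nat -> tgraph 'I_n.+1) : Prop :=
  [/\ eta vo = ord0,
      (forall e, e <= edge_count sigma G -> incomplete sigma (Gs e)),
      trivial_incomplete (Gs 0) /\ tg_eq (relabel eta (Gs (edge_count sigma G))) G &
      (forall e, 0 < e <= edge_count sigma G -> ext_most_urgent sigma (Gs e.-1) (Gs e))].

Lemma exploration_exists : exists eta, bijective eta /\ exists Gs, exploration eta Gs.
Proof.
set M := edge_count sigma G.
have [Gs [g [g_embed count_M inc_Gs triv_Gs steps_Gs]]] := exploration_prefix (leqnn M).
have H_inc := inc_Gs M (leqnn M).
have edge_onto := embed_count_onto g_embed count_M.
have root_in : isv (Gs M) ord0 by exists VCirc; apply: incomplete_root H_inc.
have vertex_onto := embed_onto g_embed root_in (fun y z t e _ => edge_onto y z t e).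
have [N range] := incomplete_range H_inc.
have all_in := embed_onto_full range vertex_onto.
have g_inj : injective g by move=> i j; apply: (embed_inj g_embed (all_in i) (all_in j)).
pose eta x := odflt ord0 [pick i | g i == x].
have etaK : cancel eta g.
  move=> x; rewrite /eta; case: pickP => [i /eqP //|none].
  by have [j [_ gj]] := vertex_onto x; move: (none j); rewrite gj eqxx.
have getaK : cancel g eta by move=> i; apply: g_inj; rewrite etaK.
exists eta; split; first by exists g.
exists Gs; split=> //.
- by rewrite -(embed_root g_embed) getaK.
- split=> //; split=> [x a|x y t] /=; first by rewrite (embed_vtE g_embed) ?etaK.
  apply/idP/idP => [/(embed_ed g_embed)|e]; first by rewrite !etaK.
  by have [i [j [eij [<- <-]]]] := edge_onto _ _ _ e; rewrite !getaK.
Qed.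


Section Run.
Variables (eta : T -> 'I_n.+1) (g : 'I_n.+1 -> T) (Gs : nat -> tgraph 'I_n.+1).
Hypotheses (etaK : cancel eta g) (getaK : cancel g eta) (Gs_run : exploration eta Gs).
Local Notation M := (edge_count sigma G).

Lemma run_incomplete e : e <= M -> incomplete sigma (Gs e).
Proof. by case: Gs_run => _ inc _ _; apply: inc. Qed.

Lemma run_step e : 0 < e <= M -> ext_most_urgent sigma (Gs e.-1) (Gs e).
Proof. by case: Gs_run => _ _ _ step; apply: step. Qed.

Lemma run_vt_final i a : vt (Gs M) i a = vt G (g i) a.
Proof. by case: Gs_run => _ _ [_ [vtE _]] _; rewrite -vtE /= getaK. Qed.

Lemma run_ed_final i j t : ed (Gs M) i j t = ed G (g i) (g j) t.
Proof. by case: Gs_run => _ _ [_ [_ edE]] _; rewrite -edE /= !getaK. Qed.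

Lemma run_grow_step e : e < M ->
  (forall i a, vt (Gs e) i a -> vt (Gs e.+1) i a) /\
  (forall i j t, ed (Gs e) i j t -> ed (Gs e.+1) i j t).
Proof.
move=> e_lt; have [v [s [_ [_ [vt_next [w [_ ed_next]]]]]]] := run_step (e := e.+1) e_lt.
by split=> // i j t eij; rewrite ed_next eij.
Qed.

Lemma run_grow e : e <= M ->
  (forall i a, vt (Gs e) i a -> vt (Gs M) i a) /\
  (forall i j t, ed (Gs e) i j t -> ed (Gs M) i j t).
Proof.
move=> e_le; move: (subnK e_le); move: (M - e) => d.
elim: d e {e_le} => [e|d IH e]; first by rewrite add0n => ->.
move=> Ed; have e_lt : e < M by rewrite -Ed addSn ltnS leq_addl.
have [grow_vt grow_ed] := run_grow_step e_lt.
have Ed' : d + e.+1 = M by rewrite addnS -addSn.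
have [IH_vt IH_ed] := IH e.+1 Ed'.
by split=> [i a /grow_vt/IH_vt|i j t /grow_ed/IH_ed].
Qed.

Lemma run_embed e : (exists x y t, ed G x y t) -> e <= M -> embed (Gs e) g.
Proof.
move=> G_edge e_le; have [grow_vt grow_ed] := run_grow e_le.
split.
- move=> i [b ib] a; have gib : vt G (g i) b by rewrite -run_vt_final grow_vt.
  apply/idP/idP => [/grow_vt|gia]; first by rewrite run_vt_final.
  by rewrite (vtype_uniq G_edge gia gib).
- move=> i j t eij; have [ij_in _] := run_incomplete e_le.
  have [hi hj _] := proj2 ij_in _ _ _ eij.
  by split=> //; rewrite -run_ed_final grow_ed.
- by move=> i j _ _ gij; rewrite -(getaK i) -(getaK j) gij.
- by case: Gs_run => eta_vo _ _ _; rewrite -eta_vo etaK.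
Qed.

Lemma run_extension e : e < M -> exists v s w,
  [/\ most_urgent sigma (Gs e) v s, incomplete sigma (Gs e.+1),
      forall i a, vt (Gs e) i a -> vt (Gs e.+1) i a,
      forall x y t,
        ed (Gs e.+1) x y t = ed (Gs e) x y t || ((x, y, t) == ext_edge sigma s v w) &
      edge_in G (ext_edge sigma s (g v) (g w))].
Proof.
move=> e_lt.
have [v [s [urgent [inc_next [vt_next [w [_ ed_next]]]]]]] := run_step (e := e.+1) e_lt.
exists v, s, w; split=> //.
have : edge_in (Gs e.+1) (ext_edge sigma s v w).
  by rewrite /edge_in ed_next -!surjective_pairing eqxx orbT.
move/((run_grow e_lt).2); rewrite /edge_in run_ed_final.
by rewrite /ext_edge; case: ifP.
Qed.

End Run.

Section Uniqueness.
Variables (eta1 : T -> 'I_n.+1) (g1 : 'I_n.+1 -> T) (Gs1 : nat -> tgraph 'I_n.+1).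
Variables (eta2 : T -> 'I_n.+1) (g2 : 'I_n.+1 -> T) (Gs2 : nat -> tgraph 'I_n.+1).
Hypotheses (etaK1 : cancel eta1 g1) (getaK1 : cancel g1 eta1) (run1 : exploration eta1 Gs1).
Hypotheses (etaK2 : cancel eta2 g2) (getaK2 : cancel g2 eta2) (run2 : exploration eta2 Gs2).
Local Notation M := (edge_count sigma G).

Lemma runs_agree_step e : e < M ->
  Gs1 e = Gs2 e -> (forall i, isv (Gs1 e) i -> g1 i = g2 i) ->
  Gs1 e.+1 = Gs2 e.+1 /\ (forall i, isv (Gs1 e.+1) i -> g1 i = g2 i).
Proof.
move=> e_lt Gs_eq agree.
have G_edge : exists x y t, ed G x y t.
  have /card_gt0P [[[x y] t]] : 0 < M by apply: leq_ltn_trans e_lt.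
  by rewrite inE => exy; exists x, y, t.
have [v [s [w1 [urgent1 inc1 vt1 ed1 edge1]]]] := run_extension getaK1 run1 e_lt.
have [v2 [s2 [w2 [urgent2 inc2 vt2 ed2 edge2]]]] := run_extension getaK2 run2 e_lt.
rewrite -Gs_eq in urgent2 vt2 ed2.
have [Ev Es] := most_urgent_uniq urgent1 urgent2; subst v2 s2.
have H_inc := run_incomplete run1 (ltnW e_lt).
have v_in := loose_end_isv (proj1 urgent1).
have isv1 := extension_isv H_inc inc1 v_in vt1 ed1.
have isv2 := extension_isv H_inc inc2 v_in vt2 ed2.
have g_w : g1 w1 = g2 w2 by apply: ext_edge_uniq edge1 _; rewrite (agree _ v_in).
have w_eq : w1 = w2.
  have [w1_in|w1_out] := classic (isv (Gs1 e) w1).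
    by apply: (can_inj getaK2); rewrite -(agree _ w1_in) g_w.
  have [w2_in|w2_out] := classic (isv (Gs1 e) w2).
    by apply: (can_inj getaK1); rewrite (agree _ w2_in) g_w.
  have [N range] := incomplete_range H_inc.
  apply: ord_inj; rewrite (extension_fresh H_inc inc1 v_in vt1 ed1 range w1_out).
  by rewrite (extension_fresh H_inc inc2 v_in vt2 ed2 range w2_out).
subst w2.
have agree' i : isv (Gs1 e.+1) i -> g1 i = g2 i by case/isv1 => [/agree|->].
split=> //; apply: tg_eqP; split=> [i a|x y t]; last by rewrite ed1 ed2.
have [i_in|i_out] := classic (isv (Gs1 e.+1) i).
  have i_in2 : isv (Gs2 e.+1) i by apply/isv2/isv1.
  rewrite (embed_vtE (run_embed etaK1 getaK1 run1 G_edge e_lt) a i_in).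
  by rewrite (embed_vtE (run_embed etaK2 getaK2 run2 G_edge e_lt) a i_in2) agree'.
have i_out2 : ~ isv (Gs2 e.+1) i by move/isv2/isv1.
by apply/idP/idP => ia; [case: i_out|case: i_out2]; exists a.
Qed.

Lemma runs_agree e : e <= M ->
  Gs1 e = Gs2 e /\ (forall i, isv (Gs1 e) i -> g1 i = g2 i).
Proof.
elim: e => [_|e IH e_lt]; last by have [] := IH (ltnW e_lt); apply: runs_agree_step.
case: run1 run2 => eta1_vo _ [[triv1 no_ed1] _] _ [eta2_vo _ [[triv2 no_ed2] _] _].
split=> [|i [a /triv1 [-> _]]]; last by rewrite -{1}eta1_vo etaK1 -eta2_vo etaK2.
apply: tg_eqP; split=> [i a|i j t].
  by apply/idP/idP => h; [apply/triv2/triv1|apply/triv1/triv2].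
by rewrite (negbTE (no_ed1 i j t)) (negbTE (no_ed2 i j t)).
Qed.

Lemma runs_label_eq x : eta1 x = eta2 x.
Proof.
have [_ agree] := runs_agree (leqnn M).
have x_in : isv (Gs1 M) (eta1 x).
  by have [a xa] := G_typed x; exists a; rewrite (run_vt_final getaK1 run1) etaK1.
by rewrite -{2}(etaK1 x) (agree _ x_in) getaK2.
Qed.

End Uniqueness.

End Exploration.

Theorem mainTheorem8 (sigma : nat) (T : finType) (G : tgraph T) (vo : T) :
  (2 <= sigma)%N ->
  (forall v : T, isv G v) ->
  toom sigma G -> vt G vo VCirc -> tconnected sigma G ->
  ~ (exists v0 : T, trivial_at G v0) ->
  let N := #|T|.-1 in
  let M := edge_count sigma G in
  exists eta : T -> 'I_N.+1,
    (bijective eta /\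
     exists Gs : nat -> tgraph 'I_N.+1,
       [/\ eta vo = ord0,
           (forall e, (e <= M)%N -> incomplete sigma (Gs e)),
           trivial_incomplete (Gs 0) /\ tg_eq (relabel eta (Gs M)) G &
           (forall e, (0 < e <= M)%N -> ext_most_urgent sigma (Gs e.-1) (Gs e))]) /\
    (forall eta' : T -> 'I_N.+1,
       (bijective eta' /\
        exists Gs : nat -> tgraph 'I_N.+1,
          [/\ eta' vo = ord0,
              (forall e, (e <= M)%N -> incomplete sigma (Gs e)),
              trivial_incomplete (Gs 0) /\ tg_eq (relabel eta' (Gs M)) G &
              (forall e, (0 < e <= M)%N -> ext_most_urgent sigma (Gs e.-1) (Gs e))]) ->
       forall v, eta' v = eta v).
Proof.
move=> sigma_gt1 G_typed G_toom vo_circ G_connected G_nontrivial N M.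
have [eta [[g etaK getaK] [Gs Gs_run]]] :=
  exploration_exists sigma_gt1 G_typed G_toom vo_circ G_connected G_nontrivial.
exists eta; split; first by split; [exists g|exists Gs].
move=> eta' [[g' etaK' getaK'] [Gs' Gs'_run]] x.
exact: (runs_label_eq G_typed G_toom G_connected etaK' getaK' Gs'_run etaK getaK Gs_run).
Qed.
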